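(* If $G$ is a graph of order $n$ containing no universal vertex (i.e. no vertex of degree $n-1$), then $SC(G)\ge 2\,d_{st}(G)$.
   Context: Graphs are finite, simple and undirected, with nonempty vertex set $V(G)$; the order is $n=|V(G)|$. A set $D\subseteq V(G)$ is a strong dominating set of $G$ if for every $x\in V(G)\setminus D$ there is $y\in D$ with $xy\in E(G)$ and $\deg(x)\le\deg(y)$. The strong domatic number $d_{st}(G)$ is the maximum number of sets in a partition of $V(G)$ into strong dominating sets. Two disjoint sets $V_1,V_2\subseteq V(G)$ form a strong coalition if neither is a strong dominating set but $V_1\cup V_2$ is a strong dominating set. A strong coalition partition of $G$ is a partition $\Omega=\{V_1,\dots,V_k\}$ of $V(G)$ into nonempty sets such that each $V_i$ either is a strong dominating set consisting of a single vertex of degree $n-1$, or is not a strong dominating set but forms a strong coalition with another set $V_j\in\Omega$ that is not a strong dominating set. The strong coalition number $SC(G)$ is the maximum cardinality of a strong coalition partition of $G$, with $SC(G)=0$ if $G$ has no strong coalition partition. *)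

(* Defs.v *)
From mathcomp Require Import all_boot.

Set Implicit Arguments.
Unset Strict Implicit.
Unset Printing Implicit Defensive.

(* A finite simple graph is given by its vertex type T : finType and its
   adjacency relation e : rel T, which theorems assume to be symmetric and
   irreflexive. *)
Section StrongCoalition.

Variables (T : finType) (e : rel T).

Definition deg (x : T) : nat := #|[set y | e x y]|.

Definition universal (x : T) : bool := deg x == #|T|.-1.

Definition strong_dominating (D : {set T}) : bool :=
  [forall x, (x \notin D) ==> [exists y in D, e x y && (deg x <= deg y)]].

(* The library's [partition] requires the blocks to be nonempty. *)
Definition strong_domatic_partition (P : {set {set T}}) : bool :=
  partition P [set: T] && [forall D in P, strong_dominating D].

Definition strong_domatic_number : nat :=
  \max_(P : {set {set T}} | strong_domatic_partition P) #|P|.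

Definition strong_coalition (A B : {set T}) : bool :=
  [&& [disjoint A & B], ~~ strong_dominating A, ~~ strong_dominating B
    & strong_dominating (A :|: B)].

Definition strong_coalition_partition (P : {set {set T}}) : bool :=
  partition P [set: T] &&
  [forall A in P,
    (strong_dominating A && [exists x, universal x && (A == [set x])])
    || [exists B in P, (B != A) && strong_coalition A B]].

(* The maximum of an empty family is 0, which is the convention for graphs
   without strong coalition partition. *)
Definition strong_coalition_number : nat :=
  \max_(P : {set {set T}} | strong_coalition_partition P) #|P|.

End StrongCoalition.

(* Main.v *)
Require Import Defs.
From mathcomp Require Import all_boot.

(** Shrink every block of a largest strong domatic partition [P] to a minimal
    strong dominating set, and let [W] collect the vertices left over. Then [W]
    is not strong dominating, since otherwise the shrunk blocks together with
    [W] would form a larger strong domatic partition. As no vertex is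
    universal, a minimal strong dominating set has at least two vertices; any
    cut of it into two nonempty parts gives two sets that are not strong
    dominating and whose union is, that is, a strong coalition
    ([strong_coalition_minset]). This produces [2 * #|P|] disjoint sets, each
    with a coalition partner, which cover everything but [W].

    It remains to absorb [W] ([coalition_partition_extend]). If [W] is empty,
    there is nothing to do. If [W] forms a coalition with one of the sets, it
    becomes a new block. Otherwise [W] is merged into an arbitrary block [A]:
    the union [A :|: W] is not strong dominating because [A] and [W] do not
    form a coalition, and it inherits the partners of [A] because supersets of
    strong dominating sets are strong dominating. *)

Set Implicit Arguments.
Unset Strict Implicit.
Unset Printing Implicit Defensive.

Section StrongDomatic.

Variables (T : finType) (e : rel T).
Implicit Types (A B C D W : {set T}) (P Q : {set {set T}}).

Lemma strong_dominatingS A B :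
  A \subset B -> strong_dominating e A -> strong_dominating e B.
Proof.
move=> sAB /forallP domA; apply/forallP=> x; apply/implyP=> xNB.
have /existsP[y /andP[yA exy]] := implyP (domA x) (contra (subsetP sAB x) xNB).
by apply/existsP; exists y; rewrite (subsetP sAB).
Qed.

Lemma strong_dominating_neq0 A :
  0 < #|T| -> strong_dominating e A -> A != set0.
Proof.
case/card_gt0P=> x _ /forallP/(_ x) domA; apply/eqP=> A0.
by move: domA; rewrite A0 inE => /existsP[y]; rewrite inE.
Qed.

Lemma strong_dominating1 x :
  symmetric e -> irreflexive e ->
  strong_dominating e [set x] -> universal e x.
Proof.
move=> e_sym e_irr /forallP domx; rewrite /universal /deg -(cardsC1 x).
apply/eqP; apply: eq_card => y; rewrite !inE.
have := domx y; rewrite inE; case: eqVneq => [-> | _] /=; first by rewrite e_irr.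
by case/existsP=> z /andP[/set1P-> /andP[]]; rewrite e_sym.
Qed.

Lemma strong_coalitionC A B : strong_coalition e A B = strong_coalition e B A.
Proof.
by rewrite /strong_coalition disjoint_sym setUC; congr (_ && _); rewrite andbCA.
Qed.

Lemma strong_coalition_neq A B : strong_coalition e A B -> A != B.
Proof.
by case/and4P=> _ ndA _; apply: contraTneq => <-; rewrite setUid.
Qed.

(** Cutting a minimal strong dominating set at any of its vertices. *)
Lemma strong_coalition_minset D x :
  symmetric e -> irreflexive e -> ~~ universal e x ->
  minset (strong_dominating e) D -> x \in D ->
  strong_coalition e [set x] (D :\ x).
Proof.
move=> e_sym e_irr nux minD xD; apply/and4P; split.
- by rewrite disjoints1 !inE eqxx.
- by apply: contra nux => /(strong_dominating1 e_sym e_irr).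
- apply/negP=> domDx; have eqD := minsetinf minD domDx (subsetDl _ _).
  by move: xD; rewrite -eqD !inE eqxx.
- by rewrite setD1K // (minsetp minD).
Qed.

(** [coalescent Q]: every member of [Q] has a coalition partner in [Q]. Unlike
    in a strong coalition partition, [Q] need not cover the graph. *)
Definition coalescent Q : Prop :=
  {in Q, forall A, exists2 B, B \in Q & strong_coalition e A B}.

Lemma coalescent_partition Q :
  partition Q [set: T] -> coalescent Q -> strong_coalition_partition e Q.
Proof.
move=> partQ coQ; rewrite /strong_coalition_partition partQ /=.
apply/forallP=> A; apply/implyP=> QA; apply/orP; right.
have [B QB coAB] := coQ A QA; apply/existsP; exists B.
by rewrite QB coAB eq_sym (strong_coalition_neq coAB).
Qed.

Lemma coalescentU1 Q W B :
  coalescent Q -> B \in Q -> strong_coalition e W B -> coalescent (W |: Q).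
Proof.
move=> coQ QB coWB A /setU1P[-> | QA]; first by exists B; rewrite // setU1r.
by have [C QC coAC] := coQ A QA; exists C; rewrite // setU1r.
Qed.

Lemma partition_setU1C Q :
  partition Q (cover Q) -> ~: cover Q != set0 ->
  partition (~: cover Q |: Q) [set: T] /\ #|~: cover Q |: Q| = #|Q|.+1.
Proof.
set W := ~: _ => partQ W0; split; last first.
  rewrite cardsU1 (_ : W \notin Q) //; apply/negP=> QW.
  case/set0Pn: W0 => x xW; move: (xW); rewrite inE => /negP[].
  by apply/bigcupP; exists W.
have := partitionU1 partQ W0; rewrite [W :|: _]setUC setUCr; apply.
by rewrite disjoints_subset.
Qed.

Lemma coalition_partition_extend Q :
  partition Q (cover Q) -> coalescent Q -> Q != set0 ->
  ~~ strong_dominating e (~: cover Q) ->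
  exists2 R, strong_coalition_partition e R & #|Q| <= #|R|.
Proof.
set W := ~: cover Q => partQ coQ Q0 ndW.
have [W0 | W0] := eqVneq W set0.
  exists Q => //; apply: coalescent_partition => //.
  by rewrite -[setT]setC0 -W0 setCK.
have [/existsP[B /andP[QB coWB]] | /existsPn noW] :=
    boolP [exists B in Q, strong_coalition e W B].
  have [partWQ cardWQ] := partition_setU1C partQ W0.
  exists (W |: Q); last by rewrite cardWQ.
  exact/coalescent_partition/(coalescentU1 coQ QB coWB).
have /set0Pn[A QA] := Q0.
have disjW B : B \in Q -> [disjoint W & B].
  by move=> QB; rewrite disjoint_sym disjoints_subset setCK; apply: bigcup_sup.
have ndWA : ~~ strong_dominating e (A :|: W).
  apply/negP=> domAW; have := noW A; rewrite QA /strong_coalition ndW disjW //=.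
  by rewrite setUC domAW andbT; case: (coQ A QA) => B _ /and4P[_ ->].
have coverQA : cover (Q :\ A) = cover Q :\: A.
  by apply: coverD1 QA; apply: partition_trivIset partQ.
(* The leftover of [Q :\ A] is the merged block [A :|: W]. *)
have defAW : A :|: W = ~: cover (Q :\ A).
  by rewrite coverQA setDE setCI setCK setUC.
have partQA : partition (Q :\ A) (cover (Q :\ A)).
  by rewrite coverQA; apply: partitionD1.
have [|partR cardR] := partition_setU1C partQA.
  rewrite -defAW; apply: contraNneq W0 => AW0.
  by rewrite -subset0 -AW0 subsetUr.
exists (A :|: W |: Q :\ A); last by rewrite defAW cardR (cardsD1 A Q) QA.
rewrite -defAW in partR; apply: coalescent_partition partR _.
have partner B : B \in Q -> strong_coalition e A B ->
    strong_coalition e (A :|: W) B.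
  move=> QB /and4P[dAB _ ndB domAB]; apply/and4P; split=> //.
    by rewrite disjoints_subset subUset -!disjoints_subset dAB disjW.
  by apply: strong_dominatingS domAB; rewrite setSU // subsetUl.
move=> B /setU1P[-> | /setD1P[BA QB]].
  have [C QC coAC] := coQ A QA; exists C; last exact: partner.
  by rewrite setU1r // !inE QC eq_sym (strong_coalition_neq coAC).
have [C QC coBC] := coQ B QB; have [eqCA | CA] := eqVneq C A.
  exists (A :|: W); first exact: setU11.
  by rewrite strong_coalitionC partner // strong_coalitionC -eqCA.
by exists C; rewrite // setU1r // !inE CA.
Qed.

(** Cutting every block of a family of minimal strong dominating sets. The
    pieces are indexed by a block and a boolean: the singleton of a chosen
    vertex for [true], the rest of the block for [false]. *)
Lemma coalescent_split P :
  symmetric e -> irreflexive e -> 0 < #|T| ->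
  (forall x, ~~ universal e x) ->
  partition P (cover P) -> {in P, forall D, minset (strong_dominating e) D} ->
  exists Q, [/\ partition Q (cover Q), coalescent Q,
                cover Q = cover P & #|Q| = 2 * #|P|].
Proof.
move=> e_sym e_irr T_gt0 nu partP minP; have [x0 _] := card_gt0P T_gt0.
pose pt D := odflt x0 [pick x in D].
have ptP D : D \in P -> pt D \in D.
  move=> PD; rewrite /pt; case: pickP => //= D0.
  case/negP: (partition_neq0 partP PD); apply/eqP/setP=> x.
  by rewrite inE -[RHS](D0 x).
pose half (i : {set T} * bool) := if i.2 then [set pt i.1] else i.1 :\ pt i.1.
pose J := setX P [set: bool].
have coP D : D \in P -> strong_coalition e (half (D, true)) (half (D, false)).
  by move=> PD; apply: strong_coalition_minset => //; [apply: minP | apply: ptP].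
have PJ i : i \in J -> i.1 \in P by case: i => D b; rewrite !inE andbT.
have coJ i : i \in J -> strong_coalition e (half i) (half (i.1, ~~ i.2)).
  move/PJ; case: i => D [] /coP //.
  by rewrite strong_coalitionC.
have half_sub i : i \in J -> half i \subset i.1.
  by move/PJ; case: i => D [] /ptP; rewrite /half /= ?sub1set ?subsetDl.
have [||partQ injQ] := @indexed_partition _ _ (mem J) half.
- move=> i j Ji Jj; have [eq1 | ne1] := eqVneq j.1 i.1.
    case/and4P: (coJ i Ji) => dis _ _ _ neqji.
    rewrite (_ : j = (i.1, ~~ i.2)) //; case: (i) (j) eq1 neqji => A b [B c] /= ->.
    by rewrite xpair_eqE eqxx /=; case: b; case: c.
  have /trivIsetP/(_ _ _ (PJ i Ji) (PJ j Jj)) := partition_trivIset partP.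
  rewrite eq_sym ne1 => /(_ isT) dis _.
  exact: disjointWl (half_sub i Ji) (disjointWr (half_sub j Jj) dis).
- (* An empty half would leave the other half strong dominating. *)
  move=> i Ji; case/and4P: (coJ i Ji) => _ _ ndB domAB.
  by apply: contraNneq ndB => A0; rewrite A0 set0U in domAB.
exists (half @: J); split=> //.
- move=> _ /imsetP[i Ji ->]; exists (half (i.1, ~~ i.2)); last exact: coJ.
  by apply: imset_f; rewrite inE /= PJ // inE.
- rewrite cover_imset; apply/setP=> x; apply/bigcupP/bigcupP.
    by case=> i Ji xi; exists i.1; [apply: PJ | apply: subsetP (half_sub i Ji) x xi].
  case=> D PD xD; exists (D, x == pt D); first by rewrite !inE PD.
  by rewrite /half /=; case: eqVneq => [-> | nx]; rewrite !inE ?nx.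
- by rewrite card_in_imset // cardsX cardsT card_bool mulnC.
Qed.

Lemma strong_domatic_number_attained :
  0 < #|T| ->
  exists2 P, strong_domatic_partition e P & #|P| = strong_domatic_number e.
Proof.
move=> T_gt0; have domT : strong_domatic_partition e [set [set: T]].
  apply/andP; split.
    rewrite /partition cover1 eqxx trivIset1 inE eq_sym /=.
    by rewrite -card_gt0 cardsT.
  apply/forallP=> D; apply/implyP=> /set1P->.
  by apply/forallP=> x; rewrite inE.
have [|P domP maxP] :=
    @eq_bigmax_cond _ (strong_domatic_partition e) (fun P => #|P|).
  by apply/card_gt0P; exists [set [set: T]].
by exists P.
Qed.

(** The family is obtained by shrinking the blocks of a largest strong domatic
    partition; a strong dominating leftover would be one block too many. *)
Lemma minimal_strong_domatic_family :
  0 < #|T| ->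
  exists P, [/\ partition P (cover P),
                {in P, forall D, minset (strong_dominating e) D},
                #|P| = strong_domatic_number e
              & ~~ strong_dominating e (~: cover P)].
Proof.
move=> T_gt0; have [P domP cardP] := strong_domatic_number_attained T_gt0.
have /andP[partP /forallP sdP] := domP.
pose m D := odflt D [pick M | minset (strong_dominating e) M & M \subset D].
have mP D : D \in P -> minset (strong_dominating e) (m D) /\ m D \subset D.
  move=> PD; rewrite /m; case: pickP => [M /andP[] // | noM].
  have [M minM sMD] := minset_exists (implyP (sdP D) PD).
  by have := noM M; rewrite minM sMD.
have [||partM injM] := @indexed_partition _ _ (mem P) m.
- move=> A B PA PB neBA; rewrite eq_sym in neBA.
  have /trivIsetP/(_ _ _ PA PB neBA) := partition_trivIset partP.
  by move=> dis; apply: disjointWl (mP A PA).2 (disjointWr (mP B PB).2 dis).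
- move=> D PD; apply: strong_dominating_neq0 => //.
  exact: minsetp (mP D PD).1.
have minM : {in m @: P, forall D, minset (strong_dominating e) D}.
  by move=> _ /imsetP[D PD ->]; case: (mP D PD).
have cardM : #|m @: P| = strong_domatic_number e by rewrite card_in_imset.
exists (m @: P); split=> //; apply/negP=> domW.
have [partW cardW] :=
  partition_setU1C partM (strong_dominating_neq0 T_gt0 domW).
have: #|~: cover (m @: P) |: m @: P| <= strong_domatic_number e.
  apply: (@leq_bigmax_cond _ _ (fun P => #|P|)); apply/andP; split=> //.
  by apply/forallP=> D; apply/implyP=> /setU1P[-> // | /minM/minsetp].
by rewrite cardW cardM ltnn.
Qed.

End StrongDomatic.

Theorem theorem3p1 (T : finType) (e : rel T)
  (e_sym : symmetric e) (e_irr : irreflexive e) (T_gt0 : 0 < #|T|)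
  (no_universal : forall x : T, ~~ universal e x) :
  2 * strong_domatic_number e <= strong_coalition_number e.
Proof.
have [P [partP minP cardP ndW]] := minimal_strong_domatic_family e T_gt0.
have [Q [partQ coQ covQ cardQ]] :=
  coalescent_split e_sym e_irr T_gt0 no_universal partP minP.
rewrite -cardP -cardQ; have [-> | Q0] := eqVneq Q set0; first by rewrite cards0.
rewrite -covQ in ndW.
have [R coR leQR] := coalition_partition_extend partQ coQ Q0 ndW.
exact: leq_trans leQR (leq_bigmax_cond R coR).
Qed.
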